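(* There exists a function $F^*$ feasible to the set-valued superadditive dual (SDP) of the multiobjective integer program $\max\{Cx\mid Ax\leqq b,\ x\in\mathbb{Z}^n_{\geqq}\}$ such that, for every supported efficient solution $x^*$ of this program, $Cx^*\in F^*(b)$.
   Context: Vector orders on $\mathbb{R}^k$ (and $\mathbb{R}^m$): $x\leqq y$ if $y-x$ has all nonnegative components; $x\le y$ if $x\leqq y$ and $x\ne y$. $\mathbb{R}^k_{>}$: all components positive. $A\in\mathbb{R}^{m\times n}$ with columns $A_j$, $b\in\mathbb{R}^m$, $C\in\mathbb{R}^{k\times n}$ with columns $C_j$. A feasible $x^*$ is efficient if no feasible $x$ satisfies $Cx^*\le Cx$; an efficient $x^*$ is supported if there is $\mu\in\mathbb{R}^k_{>}$ such that $x^*$ is optimal for $\max\{\mu^\top Cx\mid Ax\leqq b,\ x\in\mathbb{Z}^n_{\geqq}\}$. Set order $\preceq$: for nonempty $S,T\subseteq\mathbb{R}^k$, $S\preceq T$ if (i) for every $s\in S$ there is $t\in T$ with $s\leqq t$, and (ii) for all $s\in S,t\in T$, not $t\le s$. With two formal symbols $\pm M_\infty$: $-M_\infty\preceq S\preceq M_\infty$ for all nonempty $S\subseteq\mathbb{R}^k$, $-M_\infty\preceq-M_\infty$, $-M_\infty\preceq M_\infty$, $M_\infty\preceq M_\infty$, and $S\not\preceq-M_\infty$, $M_\infty\not\preceq S$, $M_\infty\not\preceq-M_\infty$. Let $\mathcal{E}=\{S\subseteq\mathbb{R}^k\mid S\neq\emptyset,\ \text{and } s\not\le t,\ t\not\le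 s \text{ for all } s,t\in S\}\cup\{-M_\infty,M_\infty\}$. $F:\mathbb{R}^m\to\mathcal{E}$ is nondecreasing if $\beta_1\leqq\beta_2$ implies $F(\beta_1)\preceq F(\beta_2)$, and superadditive if $F(\beta_1)+F(\beta_2)\preceq F(\beta_1+\beta_2)$ for all $\beta_1,\beta_2$, where $+$ is the Minkowski sum (extended to the symbols by $S+(-M_\infty)=-M_\infty$ for all $S\in\mathcal{E}$ and $S+M_\infty=M_\infty$ for $S\neq-M_\infty$). (SDP): minimize $F(b)$ over functions $F:\mathbb{R}^m\to\mathcal{E}$ that are superadditive and nondecreasing and satisfy $\{C_j\}\preceq F(A_j)$ for $j=1,\dots,n$ and $0\in F(0)$. Such $F$ are called feasible to (SDP).
   Formalization: The formal theorem assumes that the program has at least one supported efficient solution; without this the claim can fail: for A=0, C=1 (m=n=k=1), {1}⪯F(0) and 0∈F(0) contradict F(0)∈E, so (SDP) has no feasible function. *)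

(* Defs.v *)
From HB Require Import structures.
From mathcomp Require Import all_boot all_order all_algebra.
From mathcomp Require Import boolp classical_sets reals.

Set Implicit Arguments.
Unset Strict Implicit.
Unset Printing Implicit Defensive.

Import Order.TTheory GRing.Theory Num.Theory.

Local Open Scope classical_set_scope.
Local Open Scope ring_scope.

Definition vleqq (R : realType) (k : nat) (x y : 'cV[R]_k) : Prop :=
  forall i, x i 0 <= y i 0.

Definition vle (R : realType) (k : nat) (x y : 'cV[R]_k) : Prop :=
  vleqq x y /\ x <> y.

Definition vpos (R : realType) (k : nat) (x : 'cV[R]_k) : Prop :=
  forall i, 0 < x i 0.

Section IntegerProgram.
Variables (R : realType) (m n k : nat).
Variables (A : 'M[R]_(m, n)) (b : 'cV[R]_m) (C : 'M[R]_(k, n)).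

Definition intvec (x : 'cV[int]_n) : 'cV[R]_n := map_mx intr x.

Definition objective (x : 'cV[int]_n) : 'cV[R]_k := C *m intvec x.

Definition feasible (x : 'cV[int]_n) : Prop :=
  vleqq (A *m intvec x) b /\ (forall j, 0 <= x j 0).

Definition efficient (x : 'cV[int]_n) : Prop :=
  feasible x /\
  ~ (exists x', feasible x' /\ vle (objective x) (objective x')).

Definition scalarized_optimal (mu : 'cV[R]_k) (x : 'cV[int]_n) : Prop :=
  feasible x /\
  (forall x', feasible x' ->
     (mu^T *m objective x') 0 0 <= (mu^T *m objective x) 0 0).

Definition supported_efficient (x : 'cV[int]_n) : Prop :=
  efficient x /\ (exists mu, vpos mu /\ scalarized_optimal mu x).

End IntegerProgram.

(* A subset of R^k, or one of the two formal symbols -M_oo and M_oo. *)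
Inductive extset (R : realType) (k : nat) : Type :=
  | MinusM
  | SetOf of set 'cV[R]_k
  | PlusM.

Arguments MinusM {R k}.
Arguments PlusM {R k}.

Section ExtendedSets.
Variables (R : realType) (k : nat).
Implicit Types X Y : extset R k.

(* Intended for nonempty sets only; it is used on members of [calE], on
   Minkowski sums of such members and on singletons. *)
Definition set_le (U V : set 'cV[R]_k) : Prop :=
  (forall s, U s -> exists t, V t /\ vleqq s t) /\
  (forall s t, U s -> V t -> ~ vle t s).

Definition ext_le X Y : Prop :=
  match X, Y with
  | MinusM, _ => True
  | _, PlusM => True
  | SetOf U, SetOf V => set_le U V
  | _, _ => False
  end.

(* MinusM absorbs everything, PlusM included. *)
Definition ext_add X Y : extset R k :=
  match X, Y with
  | MinusM, _ | _, MinusM => MinusM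
  | PlusM, _ | _, PlusM => PlusM
  | SetOf U, SetOf V => SetOf [set s + t | s in U & t in V]
  end.

Definition ext_mem (y : 'cV[R]_k) X : Prop :=
  match X with
  | SetOf U => U y
  | _ => False
  end.

Definition calE X : Prop :=
  match X with
  | SetOf U => U !=set0 /\ (forall s t, U s -> U t -> ~ vle s t)
  | _ => True
  end.

End ExtendedSets.

Definition nondecreasing (R : realType) (m k : nat)
    (F : 'cV[R]_m -> extset R k) : Prop :=
  forall beta1 beta2, vleqq beta1 beta2 -> ext_le (F beta1) (F beta2).

Definition superadditive (R : realType) (m k : nat)
    (F : 'cV[R]_m -> extset R k) : Prop :=
  forall beta1 beta2,
    ext_le (ext_add (F beta1) (F beta2)) (F (beta1 + beta2)).

(* The right-hand side b enters (SDP) only through its objective F(b). *)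
Definition sdp_feasible (R : realType) (m n k : nat)
    (A : 'M[R]_(m, n)) (C : 'M[R]_(k, n))
    (F : 'cV[R]_m -> extset R k) : Prop :=
  [/\ forall beta, calE (F beta),
      superadditive F,
      nondecreasing F,
      forall j, ext_le (SetOf [set col j C]) (F (col j A))
    & ext_mem 0 (F 0)].

(* Main.v *)
Require Import Defs.
From mathcomp Require Import all_boot all_order all_algebra.
From mathcomp Require Import boolp classical_sets reals.

(** Write [V beta] for the set of objective vectors of the integer points that
    are feasible for the right-hand side [beta], and let [W] be the set of all
    positive weights whose scalarized program at [b] has an optimal solution.
    The set of nondominated points of [V beta] itself cannot serve as the value
    of the dual function: with real data a supremum over [V beta] need not be
    attained, so some points of [V beta] may lie below no nondominated one.
    So [V beta] is replaced by its outer approximation [hull beta], the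
    intersection of the half-spaces
    [dot mu y <= sup (dot mu) (V beta)], for [mu] in [W], and [F* beta] is the
    set of maximal points of [hull beta]; it is [-M_oo] when [V beta] is empty
    and [M_oo] when no weight of [W] is bounded on [V beta].

    Since [F* beta] is an antichain, condition (ii) of the set order follows
    from condition (i) ([set_le_antichain]), which is a statement about the
    hulls as soon as every point of a hull lies below a maximal one.  The latter
    holds because a hull is topologically closed, closed downwards, and bounded
    above along each axis as soon as one weight of [W] is bounded on [V beta]:
    raising one coordinate after the other as far as possible ends at a maximal
    point ([maximal_above]).  Monotonicity of the hulls is that of [V], and their
    superadditivity comes from [V beta1 + V beta2 `<=` V (beta1 + beta2)]
    ([hull_add]).

    Finally a point of [hull beta] that attains the bound of a single positive
    weight is maximal ([maximal_of_optimal]).  By the choice of [W] this puts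
    every supported efficient value into [F* b].  It also puts [0] into [F* 0]:
    a feasible point for [0] can be added to an optimal solution at [b], so its
    weighted value is at most [0]. *)

Set Implicit Arguments.
Unset Strict Implicit.
Unset Printing Implicit Defensive.

Import Order.TTheory GRing.Theory Num.Theory.

Local Open Scope classical_set_scope.
Local Open Scope ring_scope.

(** * Weights and the componentwise order *)

Section VectorOrder.
Variables (R : realType) (k : nat).
Implicit Types (x y z mu : 'cV[R]_k) (U V D : set 'cV[R]_k) (i : 'I_k).

Definition dot mu y : R := (mu^T *m y) 0 0.

Lemma dotE mu y : dot mu y = \sum_i mu i 0 * y i 0.
Proof. by rewrite /dot mxE; apply: eq_bigr => i _; rewrite mxE. Qed.

Lemma dotD mu x y : dot mu (x + y) = dot mu x + dot mu y.
Proof. by rewrite /dot mulmxDr mxE. Qed.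

Lemma dot0 mu : dot mu 0 = 0.
Proof. by rewrite /dot mulmx0 mxE. Qed.

Lemma dot_axis mu y (a : R) i :
  dot mu (y + a *: delta_mx i 0) = dot mu y + a * mu i 0.
Proof.
rewrite dotD; congr (_ + _).
rewrite dotE (bigD1 i) //= big1 => [|j ji].
  by rewrite !mxE !eqxx mulr1 addr0 mulrC.
by rewrite !mxE (negbTE ji) /= !mulr0.
Qed.

Lemma vleqq_refl x : vleqq x x.
Proof. by move=> i. Qed.

Lemma vleqq_trans y x z : vleqq x y -> vleqq y z -> vleqq x z.
Proof. by move=> xy yz i; apply: le_trans (xy i) (yz i). Qed.

Lemma vleqqD x1 x2 y1 y2 :
  vleqq x1 y1 -> vleqq x2 y2 -> vleqq (x1 + x2) (y1 + y2).
Proof. by move=> h1 h2 i; rewrite !mxE lerD. Qed.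

Lemma vleqq_anti x y : vleqq x y -> vleqq y x -> x = y.
Proof.
by move=> xy yx; apply/colP => i; apply/eqP; rewrite eq_le xy yx.
Qed.

Lemma vle_leqq_trans x y z : vle x y -> vleqq y z -> vle x z.
Proof.
move=> [xy neq] yz; split; first exact: vleqq_trans xy yz.
by move=> xz; apply: neq; apply: vleqq_anti => //; rewrite xz.
Qed.

Lemma vle_ltP x y : vle x y -> exists i, x i 0 < y i 0.
Proof.
move=> [xy neq]; apply: contrapT => h; apply: neq; apply: vleqq_anti => // i.
by rewrite leNgt; apply/negP => lt; apply: h; exists i.
Qed.

Lemma dot_le mu x y : vpos mu -> vleqq x y -> dot mu x <= dot mu y.
Proof.
move=> mu0 xy; rewrite !dotE; apply: ler_sum => i _.
by rewrite ler_wpM2l // ltW.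
Qed.

Lemma vleqq_axis x y i :
  vleqq x y -> vleqq (x + (y i 0 - x i 0) *: delta_mx i 0) y.
Proof.
move=> xy j; rewrite !mxE eqxx andbT.
case: eqVneq => [->|_]; first by rewrite mulr1 addrC subrK.
by rewrite mulr0 addr0.
Qed.

Lemma dot_lt mu x y : vpos mu -> vle x y -> dot mu x < dot mu y.
Proof.
move=> mu0 xy; have [i lti] := vle_ltP xy.
apply: lt_le_trans (dot_le mu0 (vleqq_axis i xy.1)).
by rewrite dot_axis ltrDl mulr_gt0 // subr_gt0.
Qed.

(** An element of [V] strictly below [s] would also be strictly below the
    element of [V] that dominates [s]. *)
Lemma set_le_antichain U V :
    (forall s t, V s -> V t -> ~ vle s t) ->
    (forall s, U s -> exists t, V t /\ vleqq s t) ->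
  set_le U V.
Proof.
move=> antiV domU; split=> // s t Us Vt ts.
have [t' [Vt' st']] := domU s Us.
exact: antiV Vt Vt' (vle_leqq_trans ts st').
Qed.

Definition maximal D : set 'cV[R]_k :=
  [set y | D y /\ forall z, D z -> ~ vle y z].

Lemma maximal_antichain D s t : maximal D s -> maximal D t -> ~ vle s t.
Proof. by move=> [_ smax] [Dt _]; apply: smax. Qed.

Lemma maximal_of_optimal D mu y :
  vpos mu -> D y -> (forall z, D z -> dot mu z <= dot mu y) -> maximal D y.
Proof.
move=> mu0 Dy ymax; split=> // z Dz /(dot_lt mu0).
by rewrite ltNge ymax.
Qed.

(** The coordinates are raised greedily.  Raising a later coordinate does not
    create room along an earlier one, because [D] is closed downwards; hence in
    the end no coordinate can be raised, and, again by downward closure, nothing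
    in [D] lies above. *)
Lemma maximal_above D s :
    (forall y z, vleqq y z -> D z -> D y) ->
    (forall y i, D y -> exists a : R, [/\ 0 <= a,
       D (y + a *: delta_mx i 0) &
       forall a', D (y + a' *: delta_mx i 0) -> a' <= a]) ->
  D s -> exists t, maximal D t /\ vleqq s t.
Proof.
move=> Ddown Dmax Ds.
have [t [Dt st tmax]] : exists t, [/\ D t, vleqq s t &
    forall i, i \in enum 'I_k ->
    forall a, D (t + a *: delta_mx i 0) -> a <= 0].
  elim: (enum 'I_k) => [|i r [t [Dt st tmax]]].
    by exists s; split=> //; apply: vleqq_refl.
  have [a [a0 Da amax]] := Dmax t i Dt.
  have tt' : vleqq t (t + a *: delta_mx i 0).
    by move=> j; rewrite !mxE lerDl mulr_ge0.
  exists (t + a *: delta_mx i 0); split=> //; first exact: vleqq_trans st tt'.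
  move=> j; rewrite in_cons => /orP[/eqP-> a'|jr a' Da'].
    by rewrite -addrA -scalerDl => /amax; rewrite gerDl.
  by apply: (tmax j jr); apply: Ddown Da'; apply: vleqqD (vleqq_refl _).
exists t; split=> //; split=> // z Dz tz; have [i lti] := vle_ltP tz.
have := tmax i (mem_enum _ i) _ (Ddown _ _ (vleqq_axis i tz.1) Dz).
by rewrite subr_le0 leNgt lti.
Qed.

End VectorOrder.

(** * Outer approximation of the feasible objective vectors *)

Section Hull.
Variables (R : realType) (m n k : nat).
Variables (A : 'M[R]_(m, n)) (C : 'M[R]_(k, n)).
Variable W : set 'cV[R]_k.
Hypothesis Wpos : forall mu, W mu -> vpos mu.
Implicit Types (x : 'cV[int]_n) (beta : 'cV[R]_m) (mu y : 'cV[R]_k) (c : R).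

Definition bounds mu c beta : Prop :=
  forall x, feasible A beta x -> dot mu (objective C x) <= c.

(** Quantifying over all upper bounds [c] instead of using the supremum makes a
    weight that is unbounded on the feasible set impose no constraint, and makes
    the hull empty when nothing is feasible and [W] is inhabited. *)
Definition hull beta : set 'cV[R]_k :=
  [set y | forall mu c, W mu -> bounds mu c beta -> dot mu y <= c].

Definition hull_bounded beta : Prop := exists mu c, W mu /\ bounds mu c beta.

Lemma objectiveD x1 x2 :
  objective C (x1 + x2) = objective C x1 + objective C x2.
Proof. by rewrite /objective /intvec map_mxD mulmxDr. Qed.

Lemma feasibleD beta1 beta2 x1 x2 :
  feasible A beta1 x1 -> feasible A beta2 x2 ->
  feasible A (beta1 + beta2) (x1 + x2).
Proof.
move=> [h1 p1] [h2 p2]; split=> [|j]; last by rewrite mxE addr_ge0.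
by rewrite /intvec map_mxD mulmxDr; apply: vleqqD.
Qed.

Lemma feasible_le beta1 beta2 x :
  vleqq beta1 beta2 -> feasible A beta1 x -> feasible A beta2 x.
Proof. by move=> b12 [h p]; split=> //; apply: vleqq_trans h b12. Qed.

Lemma feasible0 : feasible A 0 0.
Proof.
split=> [|j]; last by rewrite mxE.
by rewrite /intvec map_mx0 mulmx0; apply: vleqq_refl.
Qed.

Lemma intvec_delta (j : 'I_n) : intvec R (delta_mx j 0) = delta_mx j 0.
Proof. by apply/matrixP => i l; rewrite !mxE; case: (_ && _). Qed.

Lemma objective_delta (j : 'I_n) : objective C (delta_mx j 0) = col j C.
Proof. by rewrite /objective intvec_delta colE. Qed.

Lemma feasible_col (j : 'I_n) : feasible A (col j A) (delta_mx j 0).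
Proof.
split=> [|i]; last by rewrite mxE; case: (_ && _).
by rewrite intvec_delta -colE; apply: vleqq_refl.
Qed.

Lemma hull_objective beta x : feasible A beta x -> hull beta (objective C x).
Proof. by move=> fx mu c _; apply. Qed.

Lemma hull_down beta y z : vleqq y z -> hull beta z -> hull beta y.
Proof.
move=> yz hz mu c Wmu bd; apply: le_trans (hz mu c Wmu bd).
exact: dot_le (Wpos Wmu) yz.
Qed.

Lemma hull_le beta1 beta2 : vleqq beta1 beta2 -> hull beta1 `<=` hull beta2.
Proof.
move=> b12 y hy mu c Wmu bd; apply: hy => // x fx.
exact: bd (feasible_le b12 fx).
Qed.

(** A bound [c] for [beta1 + beta2] gives the bound [c - dot mu (C x2)] for
    [beta1] for each [x2] feasible for [beta2]; the first hull turns this into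
    the bound [c - dot mu y1] for [beta2]. *)
Lemma hull_add beta1 beta2 y1 y2 :
  hull beta1 y1 -> hull beta2 y2 -> hull (beta1 + beta2) (y1 + y2).
Proof.
move=> h1 h2 mu c Wmu bd.
have bd2 : bounds mu (c - dot mu y1) beta2.
  move=> x2 f2; rewrite lerBrDl -lerBrDr; apply: h1 => // x1 f1.
  by rewrite lerBrDr -dotD -objectiveD; apply/bd/feasibleD.
by have := h2 _ _ Wmu bd2; rewrite dotD lerBrDl.
Qed.

Lemma hull_bounded_le beta1 beta2 :
  vleqq beta1 beta2 -> hull_bounded beta2 -> hull_bounded beta1.
Proof.
move=> b12 [mu [c [Wmu bd]]]; exists mu, c; split=> // x fx.
exact: bd (feasible_le b12 fx).
Qed.

Lemma hull_bounded_add beta1 beta2 x2 :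
  feasible A beta2 x2 -> hull_bounded (beta1 + beta2) -> hull_bounded beta1.
Proof.
move=> f2 [mu [c [Wmu bd]]]; exists mu, (c - dot mu (objective C x2)).
split=> // x1 f1; rewrite lerBrDr -dotD -objectiveD.
exact/bd/feasibleD.
Qed.

(** Along an axis each constraint of the hull reads [a <= q] for some [q], so
    the supremum of the admissible [a] is admissible. *)
Lemma hull_maximal_above beta s :
  hull_bounded beta -> hull beta s ->
  exists t, maximal (hull beta) t /\ vleqq s t.
Proof.
move=> [mu0 [c0 [Wmu0 bd0]]].
apply: maximal_above => [y z|y i hy]; first exact: hull_down.
pose E := [set a : R | hull beta (y + a *: delta_mx i 0)].
have E0 : E 0 by rewrite /E /= scale0r addr0.
have leE mu c a : W mu -> (dot mu (y + a *: delta_mx i 0) <= c)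
                       = (a <= (c - dot mu y) / mu i 0).
  by move=> Wmu; rewrite dot_axis ler_pdivlMr ?(Wpos Wmu) // lerBrDl.
have Eub mu c : W mu -> bounds mu c beta -> ubound E ((c - dot mu y) / mu i 0).
  by move=> Wmu bd a Ea; rewrite -leE //; apply: Ea.
have supE : has_ubound E by eexists; apply: (Eub _ _ Wmu0 bd0).
exists (sup E); split; [exact: ub_le_sup| |by move=> a; apply: ub_le_sup].
move=> mu c Wmu bd; rewrite leE //; apply: ge_sup; first by exists 0.
exact: Eub.
Qed.

(** * The dual function *)

Definition outer_value beta : extset R k :=
  if `[< exists x, feasible A beta x >] then
    if `[< hull_bounded beta >] then SetOf (maximal (hull beta)) else PlusM
  else MinusM.

Variant outer_value_spec beta : extset R k -> Prop :=
  | OuterMinus of (forall x, ~ feasible A beta x) :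
      outer_value_spec beta MinusM
  | OuterSet x of feasible A beta x & hull_bounded beta :
      outer_value_spec beta (SetOf (maximal (hull beta)))
  | OuterPlus x of feasible A beta x & ~ hull_bounded beta :
      outer_value_spec beta PlusM.

Lemma outer_valueP beta : outer_value_spec beta (outer_value beta).
Proof.
rewrite /outer_value; case: asboolP => [[x fx]|nf].
  by case: asboolP => hb; [apply: OuterSet fx hb|apply: OuterPlus fx hb].
by apply: OuterMinus => x fx; apply: nf; exists x.
Qed.

Lemma outer_value_calE beta : calE (outer_value beta).
Proof.
case: outer_valueP => //= x fx hb; split=> [|s t].
  have [t [tmax _]] := hull_maximal_above hb (hull_objective fx).
  by exists t.
exact: maximal_antichain.
Qed.

Lemma set_le_maximal_hull beta (U : set 'cV[R]_k) :
  hull_bounded beta -> U `<=` hull beta -> set_le U (maximal (hull beta)).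
Proof.
move=> hb Uh; apply: set_le_antichain => [s t|s Us].
  exact: maximal_antichain.
exact: hull_maximal_above hb (Uh s Us).
Qed.

Lemma outer_value_nondecreasing : Defs.nondecreasing outer_value.
Proof.
move=> beta1 beta2 b12; case: (outer_valueP beta1) => //= x1 f1 hb1;
  case: outer_valueP => //=.
- by move=> /(_ x1); apply; apply: feasible_le f1.
- move=> _ _ hb2; apply: set_le_maximal_hull => // s [hs _].
  exact: hull_le hs.
- by move=> /(_ x1); apply; apply: feasible_le f1.
- by move=> _ _ /(hull_bounded_le b12).
Qed.

Lemma outer_value_superadditive : superadditive outer_value.
Proof.
move=> beta1 beta2.
case: (outer_valueP beta1) => //= x1 f1 hb1;
  case: (outer_valueP beta2) => //= x2 f2 hb2;
  case: outer_valueP => //=;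
  try by move=> /(_ (x1 + x2)); apply; apply: feasibleD.
- move=> _ _ hb; apply: set_le_maximal_hull => // _ [s [hs _] [t [ht _] <-]].
  exact: hull_add.
- by move=> _ _; rewrite addrC => /(hull_bounded_add f1).
- by move=> _ _ /(hull_bounded_add f2).
- by move=> _ _ /(hull_bounded_add f2).
Qed.

Lemma outer_value_optimal beta mu x :
  W mu -> feasible A beta x -> bounds mu (dot mu (objective C x)) beta ->
  ext_mem (objective C x) (outer_value beta).
Proof.
move=> Wmu fx bd; case: outer_valueP => /= [/(_ x)|_ _ _|_ _]; first exact.
  apply: maximal_of_optimal (Wpos Wmu) (hull_objective fx) _ => z hz.
  exact: hz.
by apply; exists mu, (dot mu (objective C x)).
Qed.

Lemma outer_value_sdp_feasible mu :
  W mu -> bounds mu 0 0 -> sdp_feasible A C outer_value.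
Proof.
move=> Wmu bd0; split.
- exact: outer_value_calE.
- exact: outer_value_superadditive.
- exact: outer_value_nondecreasing.
- move=> j; case: outer_valueP => //=.
    by move=> /(_ _ (feasible_col j)).
  move=> _ _ hb; apply: set_le_maximal_hull => // _ ->.
  by rewrite -objective_delta; apply/hull_objective/feasible_col.
- have obj0 : objective C 0 = 0.
    by rewrite /objective /intvec map_mx0 mulmx0.
  rewrite -[X in ext_mem X]obj0.
  by apply: outer_value_optimal Wmu feasible0 _; rewrite obj0 dot0.
Qed.

End Hull.

Theorem theorem11 (R : realType) (m n k : nat)
    (A : 'M[R]_(m, n)) (b : 'cV[R]_m) (C : 'M[R]_(k, n))
    (hsupp : exists x0 : 'cV[int]_n, supported_efficient A b C x0) :
  exists Fstar : 'cV[R]_m -> extset R k,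
    sdp_feasible A C Fstar /\
    (forall x : 'cV[int]_n, supported_efficient A b C x ->
       ext_mem (objective C x) (Fstar b)).
Proof.
pose W : set 'cV[R]_k :=
  [set mu | vpos mu /\ exists x, scalarized_optimal A b C mu x].
have Wpos mu : W mu -> vpos mu by case.
exists (outer_value A C W); split; last first.
  move=> x [_ [mu [mu0 opt]]]; have [fx xmax] := opt.
  by apply: (outer_value_optimal Wpos (mu := mu)) => //; split=> //; exists x.
have [x0 [_ [mu [mu0 opt]]]] := hsupp; have [f0 x0max] := opt.
apply: (outer_value_sdp_feasible Wpos (mu := mu)).
  by split=> //; exists x0.
(* a point feasible for 0 is a direction in which x0 can be moved *)
move=> x fx; have := feasibleD fx f0; rewrite add0r => /x0max.
by rewrite -!/(dot _ _) objectiveD dotD gerDr.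
Qed.
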